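(* For every integer $m \ge 1$, the maximum of $\sum_{v \in V(D)} d^+_D(v)^2$ over all $TT_4$-free digraphs $D$ on $m$ vertices is achieved by $T_3(m)$; that is, $T_3(m)$ is $TT_4$-free and $$\mathrm{ex}^+_{L_2}(m, TT_4) = \|d^+_{T_3(m)}\|_2^2 .$$
   Context: Digraphs are finite, loopless, and have no multiple arcs in the same direction; 2-cycles (arcs in both directions between a pair of vertices) are permitted. $d^+_D(v)$ denotes the out-degree of $v$ in $D$, and $\|d^+_D\|_2^2 = \sum_{v \in V(D)} d^+_D(v)^2$. A digraph is $H$-free if it contains no (not necessarily induced) subdigraph isomorphic to $H$. The $L_2$ Turán number is $$\mathrm{ex}^+_{L_2}(m,H) = \max\Big\{ \sum_{v\in V(D)} d^+_D(v)^2 : |V(D)| = m,\ D \text{ is } H\text{-free}\Big\}.$$ $TT_4$ is the transitive tournament on 4 vertices. $T_3(m)$ is the complete 3-partite directed Turán graph on $m$ vertices: the vertex set is partitioned into 3 parts with sizes as equal as possible (any two sizes differ by at most 1, parts may be empty), there are no arcs within parts, and for any two vertices in different parts both arcs between them are present. *)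

(* Defs.v *)
From HB Require Import structures.
From mathcomp Require Import all_boot.

Set Implicit Arguments.
Unset Strict Implicit.
Unset Printing Implicit Defensive.

(* Loopless, without parallel arcs in the same direction; (u, v) and (v, u) may
   both be present.  Arcs are a {set V * V}, rather than a rel V, so that
   digraph V is a finType. *)
Record digraph (V : finType) := Digraph {
  arcs :> {set V * V};
  arcs_loopless : [forall v, (v, v) \notin arcs] }.

HB.instance Definition _ (V : finType) := [isSub for @arcs V].
HB.instance Definition _ (V : finType) := [Finite of digraph V by <:].

Definition arc (V : finType) (D : digraph V) : rel V :=
  fun u v => (u, v) \in arcs D.

Lemma rel_loopless (V : finType) (r : rel V) : irreflexive r ->
  [forall v, (v, v) \notin [set e : V * V | r e.1 e.2]].
Proof. by move=> r_irr; apply/forallP => v; rewrite inE r_irr. Qed.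

Definition digraph_of_rel (V : finType) (r : rel V) (r_irr : irreflexive r) :
  digraph V := Digraph (rel_loopless r_irr).

Lemma arc_of_rel (V : finType) (r : rel V) (r_irr : irreflexive r) :
  arc (digraph_of_rel r_irr) =2 r.
Proof. by move=> u v; rewrite /arc inE. Qed.

Definition outdeg (V : finType) (D : digraph V) (v : V) : nat :=
  #|[set w | arc D v w]|.

Definition outdeg_norm2 (V : finType) (D : digraph V) : nat :=
  \sum_(v : V) outdeg D v ^ 2.

Definition contains (W V : finType) (H : digraph W) (D : digraph V) : bool :=
  [exists f : {ffun W -> V}, injectiveb f &&
     [forall u, forall v, arc H u v ==> arc D (f u) (f v)]].

Definition free (W V : finType) (H : digraph W) (D : digraph V) : bool :=
  ~~ contains H D.

(* Digraphs on m vertices are taken on 'I_m; ex_L2_max shows that other vertex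
   types give nothing more.  If there is no H-free digraph on m vertices
   (possible only when H has no arcs), the value is 0. *)
Definition ex_L2 (W : finType) (m : nat) (H : digraph W) : nat :=
  \max_(D : digraph 'I_m | free H D) outdeg_norm2 D.

Lemma TT_irr (k : nat) : irreflexive (fun i j : 'I_k => i < j).
Proof. by move=> i; rewrite ltnn. Qed.

Definition TT (k : nat) : digraph 'I_k := digraph_of_rel (@TT_irr k).

Lemma turan_irr (r m : nat) :
  irreflexive (fun i j : 'I_m => i %% r != j %% r).
Proof. by move=> i; rewrite eqxx. Qed.

(* For r > 0, the parts of T_r(m) are the residue classes modulo r; they are
   balanced by turan_parts_balanced. *)
Definition turan (r m : nat) : digraph 'I_m := digraph_of_rel (@turan_irr r m).

Lemma turan_parts_balanced (r m a b : nat) : a < r -> b < r ->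
  #|[set i : 'I_m | i %% r == a]| <= #|[set i : 'I_m | i %% r == b]|.+1.
Proof.
move=> lt_ar lt_br; set A := [set i | _ == a]; set B := [set i | _ == b].
have r_gt0 : 0 < r by apply: leq_trans lt_ar.
pose q (i : 'I_m) := i %/ r.
have q_inj c : {in [set i : 'I_m | i %% r == c] &, injective q}.
  move=> i j; rewrite !inE => /eqP ic /eqP jc eq_q; apply: val_inj.
  by rewrite /= (divn_eq i r) (divn_eq j r) ic jc; move: eq_q; rewrite /q => ->.
case: (set_0Vmem A) => [->|[i0 Ai0]]; first by rewrite cards0.
case: (@arg_maxnP _ i0 (mem A) q Ai0) => i Ai i_max.
have cardA : #|A| <= (q i).+1.
  have fP x : q (if x \in A then x else i) < (q i).+1.
    by rewrite ltnS; case: ifP => // Ax; apply: i_max.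
  have f_inj : {in A &, injective (fun x => Ordinal (fP x))}.
    move=> x y Ax Ay [] /=; rewrite Ax Ay; exact: q_inj Ax Ay.
  by rewrite -(card_in_imset f_inj) (leq_trans (max_card _)) ?card_ord.
apply: leq_trans cardA _; rewrite ltnS.
have ltP (k : 'I_(q i)) : k * r + b < m.
  apply: ltn_trans (ltn_ord i); rewrite (divn_eq i r) -/(q i).
  have : k.+1 * r <= q i * r by rewrite leq_mul2r (ltn_ord k) orbT.
  rewrite mulSn => h; apply: leq_trans (leq_trans h (leq_addr _ _)).
  by rewrite addnC ltn_add2r.
have g_inj : injective (fun k => Ordinal (ltP k)).
  move=> k l [] /eqP; rewrite eqn_add2r eqn_mul2r eqn0Ngt r_gt0 /= => /eqP.
  exact: val_inj.
have <- : #|codom (fun k => Ordinal (ltP k))| = q i.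
  by rewrite card_codom // card_ord.
by apply/subset_leq_card/subsetP => _ /codomP[k ->]; rewrite inE /= modnMDl modn_small.
Qed.

Lemma ex_L2_max (W V : finType) (H : digraph W) (D : digraph V) :
  free H D -> outdeg_norm2 D <= ex_L2 #|V| H.
Proof.
move=> Dfree.
have r_irr : irreflexive (fun i j : 'I_#|V| => arc D (enum_val i) (enum_val j)).
  by move=> i; apply/negbTE; move/forallP: (arcs_loopless D); apply.
pose D' := digraph_of_rel r_irr.
have -> : outdeg_norm2 D = outdeg_norm2 D'.
  rewrite /outdeg_norm2 (reindex (@enum_val V V)) /=; last first.
    exact/onW_bij/enum_val_bij.
  apply: eq_bigr => i _; congr (_ ^ 2); rewrite /outdeg.
  rewrite -(card_imset [set w | arc D' i w] (@enum_val_inj V V)).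
  apply: eq_card => w; rewrite inE; apply/idP/imsetP => [Dw | [j D'j ->]].
    by exists (enum_rank w); rewrite ?enum_rankK // inE arc_of_rel enum_rankK.
  by move: D'j; rewrite inE arc_of_rel.
apply: (@leq_bigmax_cond _ (free H) (@outdeg_norm2 _) D').
apply: contra Dfree => /existsP[f /andP[/injectiveP f_inj /forallP f_arc]].
apply/existsP; exists [ffun w => enum_val (f w)]; apply/andP; split.
  by apply/injectiveP => u v; rewrite !ffunE => /enum_val_inj /f_inj.
apply/forallP => u; apply/forallP => v; rewrite !ffunE -(arc_of_rel r_irr).
by move/forallP: (f_arc u); apply.
Qed.

(* Main.v *)
From mathcomp Require Import all_boot.
From mathcomp Require Import zify ring.
Require Import Defs.

Set Implicit Arguments.
Unset Strict Implicit.
Unset Printing Implicit Defensive.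

(** The result holds with [r >= 3] parts in place of 3, and rests on two facts.

    Erdős's degree majorization survives for out-degrees: the vertices of a
    [TT r.+1]-free digraph can be coloured with [r] colours so that no vertex
    has more out-neighbours than there are vertices of other colours
    ([outdeg_majorization]).  Indeed, let [x] have maximum out-degree and let
    [S] be its out-neighbourhood.  Prepending [x] to a transitive tournament
    of [S] gives a longer one, so [S] is [TT r]-free and is coloured by
    induction with [r.-1] colours; all vertices outside [S] receive one new
    colour.  Outside [S] the bound is the maximality of [x]; inside [S] a
    vertex gains at most all the vertices outside [S].

    It remains to maximize the sum of [f (a_i)], for [f a = a * (m - a) ^ 2],
    over the part sizes [a_1 + ... + a_r = m].  Although [f] is not concave on
    the whole of [[0, m]], it lies at all integers of that interval below its
    secant through [q] and [q.+1], where [q] is the smallest part of the Turán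
    graph ([secant_bound]).  The sum of an affine function depends only on
    [m], and the Turán graph has only parts of sizes [q] and [q.+1], where the
    bound is an equality. *)

(** * Transitive tournaments as sequences *)

Section TransitiveTournaments.

Variables (V : finType) (D : digraph V).

Lemma arc_irr : irreflexive (arc D).
Proof. by move=> v; apply/negbTE; move/forallP: (arcs_loopless D); apply. Qed.

(** Looplessness makes the entries of [s] distinct, so that [pairwise] alone
    describes a copy of a transitive tournament. *)
Lemma pairwise_contains_TT (s : seq V) :
  pairwise (arc D) s -> contains (TT (size s)) D.
Proof.
case: s => [|x0 s'].
  move=> _; apply/existsP; exists (ffun0 (card_ord 0)).
  by apply/andP; split; [apply/injectiveP | apply/forallP] => -[].
set s := x0 :: s' => /(pairwiseP x0) s_arc.
have arc_nth (i j : 'I_(size s)) : i < j -> arc D (nth x0 s i) (nth x0 s j).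
  by apply: s_arc; rewrite inE.
apply/existsP; exists [ffun i : 'I_(size s) => nth x0 s i]; apply/andP; split.
  apply/injectiveP => i j; rewrite !ffunE => eq_ij; apply: val_inj => /=.
  by case: (ltngtP i j) => // /arc_nth; rewrite eq_ij arc_irr.
apply/forallP => i; apply/forallP => j; rewrite arc_of_rel !ffunE.
by apply/implyP/arc_nth.
Qed.

End TransitiveTournaments.

(** A copy of the tournament would put [r.+1] vertices into distinct residue
    classes modulo [r]. *)
Lemma turan_free (r m : nat) : 0 < r -> free (TT r.+1) (turan r m).
Proof.
move=> r_gt0; apply/existsP => -[f /andP[_ /forallP f_arc]].
have arc_f (i j : 'I_r.+1) : i < j -> f i %% r != f j %% r.
  by move=> lt_ij; have /forallP/(_ j) := f_arc i; rewrite !arc_of_rel lt_ij.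
pose g i := Ordinal (ltn_pmod (f i) r_gt0).
have g_inj : injective g.
  move=> i j [] eq_ij; apply: val_inj => /=.
  by case: (ltngtP i j) => // /arc_f; rewrite eq_ij eqxx.
by have := leq_card g g_inj; rewrite !card_ord ltnn.
Qed.

(** * Majorization of the out-degrees *)

(** The induction takes place inside one fixed digraph, on the vertex sets [A];
    a colour is a natural number, so that no colour at all ([k = 0]) is a
    legitimate number of colours for the empty set. *)
Lemma outdeg_majorization_in (V : finType) (e : rel V) (k : nat) (A : {set V}) :
  (forall s, size s = k.+1 -> {subset s <= A} -> ~~ pairwise e s) ->
  exists c : V -> nat,
    {in A, forall v, c v < k /\
      #|[set w in A | e v w]| <= #|[set w in A | c w != c v]|}.
Proof.
elim: k A => [|k IHk] A noTT.
  exists (fun=> 0) => v vA.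
  have sub : {subset [:: v] <= A} by move=> w; rewrite inE => /eqP ->.
  by have := noTT [:: v] erefl sub.
have [-> | [x0 x0A]] := set_0Vmem A; first by exists (fun=> 0) => v; rewrite inE.
pose N v := [set w in A | e v w].
have [x xA x_max] := arg_maxnP (fun v => #|N v|) x0A.
have [c cP] : exists c : V -> nat,
    {in N x, forall v, c v < k /\
      #|[set w in N x | e v w]| <= #|[set w in N x | c w != c v]|}.
  apply: IHk => s sz_s sN; apply: contra (noTT (x :: s) _ _) => [s_pw||].
  - by rewrite /= s_pw andbT; apply/allP => w /sN; rewrite inE => /andP[].
  - by rewrite /= sz_s.
  - by move=> w; rewrite inE => /predU1P[-> // | /sN]; rewrite inE => /andP[].
exists (fun v => if v \in N x then c v else k) => v vA.
have [vN | vN] := boolP (v \in N x); last first.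
  split; first exact: ltnSn.
  apply: leq_trans (x_max v vA) (subset_leq_card _); apply/subsetP => w wN.
  have [lt_cw _] := cP w wN; rewrite inE wN ltn_eqF // andbT.
  by move: wN; rewrite inE => /andP[].
have [lt_cv le_v] := cP v vN; split; first exact: ltnW.
rewrite -(cardsID (N x)) -[leqRHS](cardsID (N x)); apply: leq_add.
  apply: leq_trans (leq_trans _ le_v) _; apply: subset_leq_card.
    by apply/subsetP => w; rewrite !inE => /andP[/andP[-> ->] /andP[_ ->]].
  apply/subsetP => w; rewrite inE => /andP[wN c_w].
  by rewrite inE wN inE wN c_w !andbT; move: wN; rewrite inE => /andP[].
apply/subset_leq_card/subsetP => w; rewrite inE => /andP[wN].
rewrite inE => /andP[wA _]; rewrite inE wN inE wA /= (negbTE wN).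
by rewrite neq_ltn lt_cv orbT.
Qed.

Lemma outdeg_majorization (V : finType) (D : digraph V) (r : nat) :
  free (TT r.+1) D ->
  exists c : V -> nat,
    forall v, c v < r /\ outdeg D v <= #|[set w | c w != c v]|.
Proof.
move=> Dfree; have [s sz_s _|c cP] := @outdeg_majorization_in V (arc D) r setT.
  by apply: contra Dfree => /pairwise_contains_TT; rewrite sz_s.
have inT (P : pred V) : [set w in setT | P w] = [set w | P w].
  by apply/setP => w; rewrite !inE.
exists c => v; have [lt_cv le_v] := cP v (in_setT v); split=> //.
by rewrite (inT (arc D v)) (inT (fun w => c w != c v)) in le_v.
Qed.

(** * Optimal part sizes *)

Section ColourClasses.

Variables (V : finType) (c : V -> nat) (r : nat).
Hypothesis c_lt : forall v, c v < r.

Lemma sum_by_colour (F : nat -> nat) :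
  \sum_v F (c v) = \sum_(i < r) #|[set v | c v == i]| * F i.
Proof.
rewrite (partition_big (fun v => Ordinal (c_lt v)) predT) //=.
apply: eq_bigr => i _; rewrite -sum_nat_cond_const.
by apply: eq_big => [v | v /eqP <-] //; rewrite inE.
Qed.

Lemma sum_card_colour : \sum_(i < r) #|[set v | c v == i]| = #|V|.
Proof.
rewrite -sum1_card (sum_by_colour (fun=> 1)).
by apply: eq_bigr => i _; rewrite muln1.
Qed.

Lemma card_other_colours (v : V) :
  #|[set w | c w != c v]| = #|V| - #|[set w | c w == c v]|.
Proof.
rewrite -(cardsC [set w | c w == c v]) addKn.
by apply: eq_card => w; rewrite !inE.
Qed.

Lemma sum_other_colours_sq :
  \sum_v #|[set w | c w != c v]| ^ 2 =
  \sum_(i < r) #|[set v | c v == i]| * (#|V| - #|[set v | c v == i]|) ^ 2.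
Proof.
rewrite -(sum_by_colour (fun i => (#|V| - #|[set v | c v == i]|) ^ 2)).
by apply: eq_bigr => v _; rewrite card_other_colours.
Qed.

End ColourClasses.

(** The right-hand side minus the left-hand side is
    [(a - q) * (a - q.+1) * (2 * m - 2 * q - 1 - a)]: the cubic
    [a * (m - a) ^ 2] minus its secant through [q] and [q.+1] vanishes at both
    points, and its three roots add up to [2 * m].  The first two factors are
    consecutive integers and the third is nonnegative since [2 * q < m].  The
    negative part of the slope of the secant, [K], is kept on the left to stay
    free of subtraction. *)
Lemma secant_bound (m q a : nat)
    (K := q * q.+1 + (2 * q + 1) * (2 * m - 2 * q - 1)) :
  2 * q < m -> a <= m ->
  a * (m - a) ^ 2 + K * a <= m ^ 2 * a + q * q.+1 * (2 * m - 2 * q - 1).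
Proof.
rewrite {}/K => lt_2q /subnKC; move: (m - a) => d def_m.
have [k def_k] : exists k, m = 2 * q + 1 + k by exists (m - (2 * q + 1)); lia.
have -> : 2 * m - 2 * q - 1 = m + k by lia.
set lhs := (X in X <= _); set rhs := (X in _ <= X).
(* In all cases [b * b.+1] is the product of the first two factors, with [b]
   the distance from [a] to the interval [[q, q.+1]], and [k + d] is the third
   factor.  The cases only serve to eliminate variables without subtraction. *)
suff [b gap] : exists b, rhs = lhs + b * b.+1 * (k + d).
  by rewrite gap leq_addr.
have [le_aq | lt_qa] := leqP a q.
  have [b def_q] : exists b, q = a + b by exists (q - a); lia.
  have def_d : d = a + 2 * b + 1 + k by lia.
  by exists b; rewrite /lhs /rhs def_d def_k def_q; ring.
have [b def_a] : exists b, a = q + 1 + b by exists (a - q.+1); lia.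
exists b; rewrite /lhs /rhs -def_m def_a.
have [le_bq | lt_qb] := leqP b q.
  have [t def_q] : exists t, q = b + t by exists (q - b); lia.
  have def_d : d = t + k by lia.
  by rewrite def_d def_q; ring.
have [t def_b] : exists t, b = q + t by exists (b - q); lia.
have def_k' : k = t + d by lia.
by rewrite def_k' def_b; ring.
Qed.

Lemma secant_eq (m q a : nat)
    (K := q * q.+1 + (2 * q + 1) * (2 * m - 2 * q - 1)) :
  2 * q < m -> q <= a <= q.+1 ->
  a * (m - a) ^ 2 + K * a = m ^ 2 * a + q * q.+1 * (2 * m - 2 * q - 1).
Proof.
rewrite {}/K => lt_2q qa.
have [k ->] : exists k, m = 2 * q + 1 + k by exists (m - (2 * q + 1)); lia.
have -> : 2 * (2 * q + 1 + k) - 2 * q - 1 = 2 * q + 1 + k + k by lia.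
have [-> | ->] : a = q \/ a = q.+1 by lia.
  have -> : 2 * q + 1 + k - q = q + 1 + k by lia.
  by ring.
have -> : 2 * q + 1 + k - q.+1 = q + k by lia.
by ring.
Qed.

(** [secant_bound] is summed over the parts.  Three parts ensure its hypothesis
    [2 * q < m] unless [m = 0]; two parts of size [q] would give [m = 2 * q],
    and the secant through [q] and [q.+1] can then fail to be a bound at [m]. *)
Lemma balanced_parts_max (r m q : nat) (a t : 'I_r -> nat) : 2 < r ->
  \sum_i a i = m -> \sum_i t i = m -> (forall i, q <= t i <= q.+1) ->
  \sum_i a i * (m - a i) ^ 2 <= \sum_i t i * (m - t i) ^ 2.
Proof.
move=> r_gt2 sum_a sum_t t_bal.
have le_m (b : 'I_r -> nat) i : \sum_i b i = m -> b i <= m.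
  by move=> <-; rewrite (bigD1 i) //= leq_addr.
have [m0 | m_gt0] := posnP m.
  rewrite big1 // => i _; have := le_m a i sum_a.
  by rewrite m0 leqn0 => /eqP ->.
have lt_2q : 2 * q < m.
  have : r * q <= m.
    rewrite -sum_t -[r in r * q]card_ord -sum_nat_const.
    by apply: leq_sum => i _; case/andP: (t_bal i).
  nia.
have scale K (b : 'I_r -> nat) : \sum_i b i = m -> K * m = \sum_i K * b i.
  by move=> <-; rewrite big_distrr.
set K := q * q.+1 + (2 * q + 1) * (2 * m - 2 * q - 1).
rewrite -(leq_add2r (K * m)) {1}(scale K a) // (scale K t) // -!big_split /=.
rewrite [leqRHS](eq_bigr _ (fun i _ => secant_eq lt_2q (t_bal i))).
rewrite [leqRHS]big_split /= -(scale _ t) // (scale _ a) // -big_split /=.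
by apply: leq_sum => i _; apply: secant_bound lt_2q (le_m a i sum_a).
Qed.

(** * Optimality of the Turán graph *)

Lemma outdeg_norm2_turan (r m : nat) : 0 < r ->
  outdeg_norm2 (turan r m) =
  \sum_(i < r) #|[set v : 'I_m | v %% r == i]| *
     (m - #|[set v : 'I_m | v %% r == i]|) ^ 2.
Proof.
move=> r_gt0; pose c (v : 'I_m) := v %% r.
have c_lt v : c v < r by apply: ltn_pmod.
have := sum_other_colours_sq c_lt; rewrite card_ord => <-.
apply: eq_bigr => v _; congr (_ ^ 2); apply: eq_card => w.
by rewrite !inE arc_of_rel eq_sym.
Qed.

Lemma outdeg_norm2_le_turan (r m : nat) (D : digraph 'I_m) :
  2 < r -> free (TT r.+1) D -> outdeg_norm2 D <= outdeg_norm2 (turan r m).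
Proof.
move=> r_gt2 /outdeg_majorization[c cP].
have r_gt0 : 0 < r by apply: ltn_trans r_gt2.
have c_lt v : c v < r by case: (cP v).
pose t i := #|[set v : 'I_m | v %% r == i]|.
have [i _ i_min] :=
  arg_minnP (fun i : 'I_r => t i) (isT : predT (Ordinal r_gt0)).
apply: (@leq_trans (\sum_v #|[set w | c w != c v]| ^ 2)).
  by apply: leq_sum => v _; rewrite leq_exp2r //; case: (cP v).
rewrite (sum_other_colours_sq c_lt) outdeg_norm2_turan // card_ord.
apply: (balanced_parts_max (q := t i)) => // [||j].
- by rewrite sum_card_colour // card_ord.
- rewrite (@sum_card_colour _ (fun v : 'I_m => v %% r)) ?card_ord // => v.
  exact: ltn_pmod.
- by rewrite i_min //=; apply: turan_parts_balanced.
Qed.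

Theorem theorem3p1 (m : nat) (hm : 1 <= m) :
  free (TT 4) (turan 3 m) /\ ex_L2 m (TT 4) = outdeg_norm2 (turan 3 m).
Proof.
have turan3_free : free (TT 4) (turan 3 m) by apply: turan_free.
split=> //; apply/eqP; rewrite eqn_leq; apply/andP; split.
  by apply/bigmax_leqP => D; apply: outdeg_norm2_le_turan.
exact: (@leq_bigmax_cond _ (free (TT 4)) (@outdeg_norm2 _)).
Qed.
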